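(* Let $G$ be a nontrivial finite abelian group and let $n$ denote its exponent. Then $\mathsf{D}_{\mathbb{Z} \setminus n\mathbb{Z}}(G) = \operatorname{rank}_n(G) + 1$.
   Context: Groups are written additively. For a nontrivial finite abelian group $G \cong C_{n_1}\oplus\dots\oplus C_{n_r}$ with $1 < n_1 \mid \dots \mid n_r$ (where $C_m$ is cyclic of order $m$) and an integer $n$, $\operatorname{rank}_n(G) = |\{ i \colon n \mid n_i\}|$. For a non-empty set of weights $A \subset \mathbb{Z}$, $\mathsf{D}_A(G)$ is the smallest positive integer $\ell$ such that for every sequence $g_1, \dots, g_k$ of elements of $G$ (repetitions allowed) with $k \ge \ell$ there exist a non-empty subset $I \subset \{1,\dots,k\}$ and weights $a_i \in A$ ($i \in I$) with $\sum_{i\in I} a_i g_i = 0$. *)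

(* Defs.v *)
From HB Require Import structures.
From mathcomp Require Import all_boot all_order all_algebra.
From mathcomp Require Import all_fingroup all_solvable.

Set Implicit Arguments.
Unset Strict Implicit.
Unset Printing Implicit Defensive.

Import GRing.Theory.
Local Open Scope ring_scope.

(* [abelian_type [set: G]] lists the invariant factors of G, all > 1, in the  *)
(* order n_r, ..., n_1 (largest first); see [abelian_structure],              *)
(* [abelian_type_gt1] and [abelian_type_dvdn_sorted].                         *)
Definition rank_at (G : finZmodType) (n : int) : nat :=
  count (fun m : nat => (n %| m%:Z)%Z) (abelian_type [set: G]).

Definition has_weighted_zero_sum (A : {pred int}) (G : finZmodType) (k : nat)
    (g : 'I_k -> G) : Prop :=
  exists (I : {set 'I_k}) (a : 'I_k -> int),
    [/\ I != set0, forall i, i \in I -> a i \in A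
      & \sum_(i in I) g i *~ a i = 0].

Definition forces_weighted_zero_sum (A : {pred int}) (G : finZmodType)
    (l : nat) : Prop :=
  forall (k : nat) (g : 'I_k -> G), (l <= k)%N -> has_weighted_zero_sum A g.

(* D_A(G) as a relation: [is_davenport A G l] means D_A(G) = l.  It is        *)
(* functional in l by [is_davenport_unique].                                  *)
Definition is_davenport (A : {pred int}) (G : finZmodType) (l : nat) : Prop :=
  [/\ (0 < l)%N, forces_weighted_zero_sum A G l
    & forall m : nat, (0 < m)%N -> forces_weighted_zero_sum A G m -> (l <= m)%N].

Lemma is_davenport_unique (A : {pred int}) (G : finZmodType) (l1 l2 : nat) :
  is_davenport A G l1 -> is_davenport A G l2 -> l1 = l2.
Proof.
move=> [l1_gt0 F1 min1] [l2_gt0 F2 min2].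
by apply/eqP; rewrite eqn_leq min1 ?min2.
Qed.

Definition nonmultiples (n : int) : {pred int} := [pred a : int | ~~ (n %| a)%Z].

(* Main.v *)
(* Let r be the number of invariant factors equal to the exponent n.  The r   *)
(* corresponding basis elements only have zero sums with weights in nZ, so    *)
(* D > r.  Conversely, the invariant factors other than n all divide a proper *)
(* divisor of n, hence divide m = n / p for some prime p; thus m G has at     *)
(* most p^r elements.  For k > r elements g_i, the pigeonhole principle gives *)
(* two families v, w : {0, ..., k-1} -> {0, ..., p-1} with the same value of  *)
(* m sum_i v_i g_i, and the nonzero weights (v_i - w_i) m are not in nZ.      *)
Require Import Defs.
From HB Require Import structures.
From mathcomp Require Import all_boot all_order all_algebra.
From mathcomp Require Import all_fingroup all_solvable.

Set Implicit Arguments.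
Unset Strict Implicit.
Unset Printing Implicit Defensive.

Import GRing.Theory.
Local Open Scope ring_scope.

(** A basis [b] of the group governs both bounds. Its elements of order n carry no zero sum with
    weights outside nZ, by independence ([dprod_cycles_free], [dprod_not_forces_nonmultiples]). With
    n = p m from [sorted_dvdn_prime_cofactor], multiplication by m kills every other basis element
    and leaves these with order p; [card_powers_dprod_le] turns this into a bound on mG, and
    [forces_nonmultiples] is the pigeonhole step. *)

Lemma card_powers_dprod_le (gT : finGroupType) (G : {group gT}) (b : seq gT)
    (m : nat) :
  (\big[dprod/1]_(x <- b) <[x]>)%g = G ->
  (#|[set (y ^+ m)%g | y in G]| <= \prod_(x <- b) #[x ^+ m]%g)%N.
Proof.
elim: b G => [|x b IHb] G.
  by rewrite !big_nil => <-; rewrite imset_set1 cards1.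
rewrite !big_cons => /dprodP[[K H defK defH] defG cKH _].
have {}IHb := IHb _ defH; rewrite defH in defG cKH.
(* The factors of y = u v commute, so the m-th power of y is that of u times that of v. *)
have sGm : [set (y ^+ m)%g | y in G] \subset
    [set (u * v)%g | u in <[(x ^+ m)%g]>%g, v in [set (z ^+ m)%g | z in H]].
  apply/subsetP=> _ /imsetP[y + ->]; rewrite -defG => /mulsgP[u v xu Hv ->].
  have [i def_u] := cycleP _ _ xu.
  rewrite expgMn; last by apply/commute_sym/(centsP cKH v Hv).
  apply: imset2_f; last exact: imset_f.
  by rewrite def_u -expgM mulnC expgM mem_cycle.
apply: leq_trans (subset_leq_card sGm) _; rewrite curry_imset2X.
apply: leq_trans (leq_imset_card _ _) _.
by rewrite cardsX orderE leq_mul2l IHb orbT.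
Qed.

(** In a chain decreasing for divisibility, the first entry [q] different from n is a multiple of
    all later ones. As n = c q with c > 1, a prime p dividing c can be split off, and m = (c / p) q
    is still a multiple of [q]. *)
Lemma sorted_dvdn_prime_cofactor (s : seq nat) (n : nat) :
  (1 < n)%N -> sorted [rel a b | (b %| a)%N] s -> all (dvdn^~ n) s ->
  exists p m : nat, [/\ prime p, n = (p * m)%N
    & forall a, a \in s -> (a == n) || (a %| m)%N].
Proof.
move=> n_gt1 s_sorted s_dvd.
have [q [q_dvd q_neq qP]] : exists q : nat, [/\ (q %| n)%N, q != n
    & forall a, a \in s -> (a == n) || (a %| q)%N].
  have tr : transitive [rel a b : nat | (b %| a)%N].
    by move=> b a c /= ba cb; apply: dvdn_trans ba.
  have := sorted_filter tr (predC1 n) s_sorted.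
  have mems a : a \in s -> (a == n) || (a \in filter (predC1 n) s).
    by move=> sa; rewrite mem_filter sa andbT /= orbN.
  case def_t: (filter _ s) mems => [|q t] mems t_sorted.
    (* Here all entries equal n, and 1 serves as the proper divisor. *)
    exists 1%N; split; rewrite ?dvd1n 1?neq_ltn ?n_gt1 // => a /mems.
    by rewrite in_nil orbF => ->.
  have : q \in filter (predC1 n) s by rewrite def_t mem_head.
  rewrite mem_filter => /andP[q_neq sq].
  exists q; split=> // [|a /mems]; first exact: (allP s_dvd).
  rewrite inE => /or3P[-> // | /eqP-> | ta]; rewrite ?dvdnn ?orbT //.
  by have /= -> := allP (order_path_min tr t_sorted) _ ta; rewrite orbT.
case/dvdnP: q_dvd => c def_n; have c_gt1 : (1 < c)%N.
  case: c def_n => [|[|c]] // def_n; first by rewrite def_n in n_gt1.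
  by rewrite def_n mul1n eqxx in q_neq.
have [d def_c] := dvdnP (pdiv_dvd c).
exists (pdiv c), (d * q)%N; split; first exact: pdiv_prime.
  by rewrite def_n {1}def_c mulnA [(d * _)%N]mulnC.
by move=> a /qP /orP[-> // | aq]; rewrite dvdn_mull ?orbT.
Qed.

Lemma forces_nonmultiples (G : finZmodType) (n p m r : nat) :
  prime p -> (0 < m)%N -> n = (p * m)%N ->
  (#|[set x *+ m | x in G]| <= p ^ r)%N ->
  forces_weighted_zero_sum (nonmultiples n) G r.+1.
Proof.
move=> p_pr m_gt0 -> le_p k g lt_r_k.
pose f (v : {ffun 'I_k -> 'I_p}) : G := (\sum_i g i *+ v i) *+ m.
have /injectivePn[v [w vw eq_f]] : ~~ injectiveb f.
  apply/injectiveP=> f_inj.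
  have : (p ^ k <= p ^ r)%N.
    rewrite -{1}(card_ord p) -{1}(card_ord k) -card_ffun -(card_imset _ f_inj).
    apply: leq_trans le_p; apply/subset_leq_card/subsetP=> _ /imsetP[u _ ->].
    exact: imset_f.
  by rewrite leq_exp2l ?prime_gt1 // leqNgt lt_r_k.
exists [set i | v i != w i], (fun i => ((v i)%:Z - (w i)%:Z) * m%:Z); split.
- apply: contraNneq vw => /setP eq0; apply/eqP/ffunP=> i.
  by have := eq0 i; rewrite !inE => /negbFE/eqP.
- move=> i; rewrite !inE; apply: contraNN => /=.
  (* Cancelling m leaves [v i] and [w i] congruent mod p; both are below p, hence equal. *)
  rewrite -> PoszM; rewrite dvdz_mul2r -?eqz_mod_dvd ?modz_nat ?modn_small //.
  by rewrite -lt0n.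
- rewrite -[RHS](subrr (f w)) -{1}eq_f /f -mulrnBl -sumrB -sumrMnl.
  rewrite [in RHS](bigID (mem [set i | v i != w i])) /= [X in _ + X]big1 ?addr0.
    by apply: eq_bigr => i _; rewrite mulrzA mulrzBr.
  by move=> i; rewrite inE negbK => /eqP->; rewrite subrr mul0rn.
Qed.

(** The element 0 decomposes uniquely along the direct product, and both the terms [b i *~ a i] and
    the constant family 0 decompose it. *)
Lemma dprod_cycles_free (G : finZmodType) (s : nat) (b : 'I_s -> G)
    (a : 'I_s -> int) :
  (\big[dprod/1]_i <[b i]>)%g = [set: G] ->
  \sum_i b i *~ a i = 0 -> forall i, b i *~ a i = 0.
Proof.
move=> defG sum0 i.
have [c [_ _ c_uniq]] := mem_bigdprod defG (in_setT (0 : G)).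
have cycle_mulrz j : true -> b j *~ a j \in <[b j]>%g.
  case: (a j) => t _; last rewrite NegzE mulrNz -FinRing.zmodVgE groupV.
    by rewrite -pmulrn -FinRing.zmodXgE mem_cycle.
  by rewrite -pmulrn -FinRing.zmodXgE mem_cycle.
rewrite (c_uniq _ cycle_mulrz (esym sum0)) //.
by rewrite -(c_uniq _ (fun j _ => group1 _)) // big1_eq.
Qed.

(** The counterexample lists the basis elements of order divisible by n. By independence, a weighted
    zero sum kills each term, so the order of the element, and with it n, divides the weight. *)
Lemma dprod_not_forces_nonmultiples (G : finZmodType) (n : nat) (b : seq G)
    (l : nat) :
  (\big[dprod/1]_(x <- b) <[x]>)%g = [set: G] ->
  (l <= count (fun x => n %| #[x]%g)%N b)%N ->
  ~ forces_weighted_zero_sum (nonmultiples n) G l.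
Proof.
rewrite (big_nth 0) big_mkord => defG le_l.
pose P := [set i : 'I_(size b) | (n %| #[nth 0%R b i]%g)%N].
have cardP : #|P| = count (fun x => n %| #[x]%g)%N b.
  by rewrite -sum1_count (big_nth 0) big_mkord sum1dep_card.
rewrite -cardP in le_l => /(_ _ (fun j => nth 0 b (@enum_val _ (mem P) j)) le_l).
case=> I [a [/set0Pn[j0 Ij0] aI sum0]].
(* Weights on the chosen basis elements, extended by 0 to the whole basis. *)
pose a' i := \sum_(j in I | enum_val j == i) a j.
have a'0 : a' (enum_val j0) = a j0.
  rewrite /a' (bigD1 j0) ?Ij0 ?eqxx //= big1 ?addr0 // => j.
  by case/andP=> /andP[_ /eqP/enum_val_inj->]; rewrite eqxx.
have /(dprod_cycles_free defG)/(_ (enum_val j0)) :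
    \sum_i nth 0 b (nat_of_ord i) *~ a' i = 0.
  rewrite -[RHS]sum0 [RHS](partition_big enum_val predT) //=.
  apply: eq_bigr => i _; rewrite /a' mulrz_sumr.
  by apply: eq_bigr => j /andP[_ /eqP->].
have := aI _ Ij0; rewrite a'0 inE /=.
have : (n %| #[nth 0%R b (@enum_val _ (mem P) j0)]%g)%N.
  by have := enum_valP j0; rewrite inE.
set x := nth _ _ _; set c := a j0 => n_dvd /negP n_ndvd xc0.
apply: n_ndvd; rewrite dvdzE; apply: dvdn_trans n_dvd _.
rewrite order_dvdn FinRing.zmodXgE; apply/eqP; rewrite pmulrn.
by case: c xc0 => t //=; rewrite NegzE mulrNz => /eqP; rewrite oppr_eq0 => /eqP.
Qed.

Theorem theorem5p2 (G : finZmodType) (n : nat) :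
  (1 < #|G|)%N -> n = exponent [set: G] ->
  is_davenport (nonmultiples n) G (rank_at G n + 1)%N.
Proof.
move=> G_gt1 def_n; rewrite addn1.
have [b defG def_t] := abelian_structure (FinRing.zmod_abelian [set: G]).
have n_gt1 : (1 < n)%N.
  rewrite def_n ltn_neqAle exponent_gt0 andbT eq_sym -dvdn1 -trivg_exponent.
  by rewrite -cardG_gt1 cardsT.
have rankE : rank_at G n = count (fun x => n %| #[x]%g)%N b.
  by rewrite /rank_at -def_t count_map.
split=> // [|l l_gt0]; last first.
  apply: contraPT; rewrite -leqNgt rankE.
  exact: dprod_not_forces_nonmultiples defG.
have [|p [m [p_pr n_pm typeP]]] :=
  sorted_dvdn_prime_cofactor n_gt1 (abelian_type_dvdn_sorted [set: G]).
  by rewrite -def_t all_map; apply/allP=> x _; rewrite def_n /= dvdn_exponent ?inE.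
have m_gt0 : (0 < m)%N.
  by rewrite lt0n; apply: contraTneq n_gt1 => m0; rewrite n_pm m0 muln0.
apply: (forces_nonmultiples p_pr m_gt0 n_pm).
(* Writing p ^ r as a product over [b], with factor p or 1, allows a comparison factor by factor. *)
rewrite rankE -sum1_count big_mkcond expn_sum.
have sub : [set x *+ m | x in G] \subset [set (y ^+ m)%g | y in [set: G]].
  by apply/subsetP=> _ /imsetP[x _ ->]; apply/imsetP; exists x; rewrite ?inE.
apply: leq_trans (subset_leq_card sub) _.
apply: leq_trans (card_powers_dprod_le m defG) _.
rewrite [X in (X <= _)%N]big_seq [X in (_ <= X)%N]big_seq.
apply: leq_prod => x bx.
(* Either x has order n = p m and [x ^+ m] has order p, or the order of x divides m and [x ^+ m] is
   trivial. *)
have /typeP /orP[/eqP x_n | x_dvd] : #[x]%g \in abelian_type [set: G].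
- by rewrite -def_t map_f.
- by rewrite x_n dvdnn orderXdiv x_n n_pm ?dvdn_mull // mulnK.
- have -> : (x ^+ m = 1)%g by apply/eqP; rewrite -order_dvdn.
  by rewrite order1 expn_gt0 prime_gt0.
Qed.
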